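(* Let $q$ be a prime power, $2\le n\le m$ integers, $\mathcal{C}\le\mathbb{F}_q^{n\times m}$ an $\mathbb{F}_q$-linear subspace of dimension $k$, and $0\le i\le k$. Suppose $\mathcal{C}$ is $i$-BMD. Then for all $i\le j\le k$: (1) for every integer $u$, $b_u^{(j)}(\mathcal{C})=0$ if $u<0$ and $b_u^{(j)}(\mathcal{C})=\begin{bmatrix} k-m(n-u-d_j) \\ j \end{bmatrix}_q$ if $u\ge0$; (2) $\displaystyle A_w^{(j)}(\mathcal{C})=\begin{bmatrix} n \\ w \end{bmatrix}_q\sum_{u=d_j}^w\begin{bmatrix} w \\ u \end{bmatrix}_q(-1)^{w-u}q^{\binom{w-u}{2}}\begin{bmatrix} k-m(n-u) \\ j \end{bmatrix}_q$ for all $0\le w\le n$ (an empty sum being $0$); (3) $\displaystyle W_\mathcal{C}^{(j)}(X,Y)=\sum_{u=d_i}^n\begin{bmatrix} k-m(n-u) \\ j \end{bmatrix}_q\mathcal{B}_{n,u}(X,Y;q)$.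
   Context: The dual is $\mathcal{C}^\perp=\{N\in\mathbb{F}_q^{n\times m}:\operatorname{Tr}(MN^t)=0\ \forall M\in\mathcal{C}\}$; $d^\perp$ is the minimum rank of a nonzero element of $\mathcal{C}^\perp$, and $d^\perp=n+1$ if $\mathcal{C}^\perp=\{0\}$. An optimal anticode is a subspace $A\le\mathbb{F}_q^{n\times m}$ with $\dim A=m\cdot\max\{\operatorname{rk}(M):M\in A\}$, and for $0\le j\le k$, $d_j=\frac1m\min\{\dim A: A\text{ an optimal anticode},\ \dim(A\cap\mathcal{C})\ge j\}$. $\mathcal{C}$ is $i$-BMD if $n-d^\perp-d_i<0$. For integers $a,b$, $\begin{bmatrix} a \\ b \end{bmatrix}_q$ is $0$ if $b<0$ or $0\le a<b$; $1$ if $b=0$; $\prod_{s=1}^b\frac{q^{a-s+1}-1}{q^s-1}$ if $b>0$, $a\ge b$; $(-1)^bq^{ab-\binom b2}\begin{bmatrix} -a+b-1 \\ b \end{bmatrix}_q$ if $b>0$, $a<0$. Weight enumerator: for $W\le\mathbb{F}_q^n$ let $A_W^{(j)}(\mathcal{C},c)$ (respectively, for $n=m$, $A_W^{(j)}(\mathcal{C},r)$) be the number of $j$-dimensional subspaces $\mathcal{D}\le\mathcal{C}$ such that the sum of the column spaces (respectively row spaces) of the elements of $\mathcal{D}$ equals $W$. For $0\le w\le n$, $A_w^{(j)}(\mathcal{C})=\sum_{\dim W=w}A_W^{(j)}(\mathcal{C},c)$ if $n<m$ and $A_w^{(j)}(\mathcal{C})=\frac12\sum_{\dim W=w}(A_W^{(j)}(\mathcal{C},c)+A_W^{(j)}(\mathcal{C},r))$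 if $n=m$. Then $W_\mathcal{C}^{(j)}(X,Y)=\sum_{w=0}^nA_w^{(j)}(\mathcal{C})X^{n-w}Y^w$. Binomial moments: for $U\le\mathbb{F}_q^n$ let $\mathcal{C}(U)$ (respectively, if $n=m$, $\mathcal{C}[U]$) be the set of $M\in\mathcal{C}$ with column space (respectively row space) contained in $U$. For $0\le u\le n$, $B_u^{(j)}(\mathcal{C})=\sum_{\dim U=u}\begin{bmatrix} \dim\mathcal{C}(U) \\ j \end{bmatrix}_q$ if $n<m$, and $B_u^{(j)}(\mathcal{C})=\frac12\sum_{\dim U=u}\Big(\begin{bmatrix} \dim\mathcal{C}(U) \\ j \end{bmatrix}_q+\begin{bmatrix} \dim\mathcal{C}[U] \\ j \end{bmatrix}_q\Big)$ if $n=m$. For integers $u$: $b_u^{(j)}(\mathcal{C})=0$ if $u<0$; $b_u^{(j)}(\mathcal{C})=B_{u+d_j}^{(j)}(\mathcal{C})\big/\begin{bmatrix} n \\ u+d_j \end{bmatrix}_q$ if $0\le u\le n-d^\perp-d_j$; $b_u^{(j)}(\mathcal{C})=\begin{bmatrix} k-m(n-u-d_j) \\ j \end{bmatrix}_q$ if $u\ge0$ and $u>n-d^\perp-d_j$. $q$-Bernstein polynomials: $\mathcal{B}_{n,u}(X,Y;q)=\begin{bmatrix} n \\ u \end{bmatrix}_qY^u\prod_{s=0}^{n-u-1}(X-q^sY)$. *)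

(* Defs.v *)
From HB Require Import structures.
From mathcomp Require Import all_boot all_order all_algebra.
From mathcomp Require Import mpoly.

Set Implicit Arguments.
Unset Strict Implicit.
Unset Printing Implicit Defensive.

Import Order.TTheory GRing.Theory Num.Theory.
Local Open Scope ring_scope.

(* Over a finite field a space has finitely many subspaces, so that one can    *)
(* count them and sum over them.                                              *)
Section FiniteSpace.

Import VectorInternalTheory.

HB.instance Definition _ (F : finFieldType) (vT : vectType F) :=
  [Countable of {vspace vT} by <:].
HB.instance Definition _ (F : finFieldType) (vT : vectType F) :=
  [Finite of {vspace vT} by <:].

End FiniteSpace.

Section Gauss.

Implicit Types (q : nat) (a b : int).

(* The product formula; the relevant value when 0 < b <= a. *)
Definition gauss_prod q a (b : nat) : rat :=
  \prod_(1 <= s < b.+1)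
     ((q%:R ^ (a - s%:Z + 1) - 1) / (q%:R ^+ s - 1)).

(* When 0 < b and a < 0 we have b <= - a + b - 1, so the binomial coefficient  *)
(* of - a + b - 1 and b is given by the product formula.                      *)
Definition gauss q a b : rat :=
  if (b < 0) || (0 <= a < b) then 0
  else if b == 0 then 1
  else if 0 <= a then gauss_prod q a `|b|%N
  else (-1) ^ b * q%:R ^ (a * b - 'C(`|b|%N, 2)%:Z)
         * gauss_prod q (- a + b - 1) `|b|%N.

Definition bernstein q (n u : nat) : {mpoly rat[2]} :=
  let X := 'X_ord0 in let Y := 'X_ord_max in
  gauss q n u *: (Y ^+ u * \prod_(0 <= s < n - u) (X - q%:R ^+ s *: Y)).

End Gauss.

Section Codes.

Variables (F : finFieldType) (n m : nat).
Local Notation Mat := 'M[F]_(n, m).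
Implicit Types (C D A : {vspace Mat}) (M N : Mat).

(* The column space, written as a space of row vectors. *)
Definition colsp M : {vspace 'rV[F]_n} := <<[seq (col j M)^T | j : 'I_m]>>%VS.
Definition rowsp M : {vspace 'rV[F]_m} := <<[seq row i M | i : 'I_n]>>%VS.

(* The span only serves to get a {vspace _}: see mem_dual. *)
Definition dual C : {vspace Mat} :=
  <<enum [pred N : Mat | [forall M in C, \tr (M *m N^T) == 0%R]]>>%VS.

(* The rank of a matrix is at most n, so the value n + 1 of the minimum is    *)
(* reached exactly when the range is empty, i.e. when dual C is 0.            *)
Definition dperp C : nat :=
  \big[minn/n.+1]_(N : Mat | (N \in dual C) && (N != 0)) \rank N.

Definition optimal_anticode A : bool :=
  \dim A == (m * \max_(M : Mat | M \in A) \rank M)%N.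

(* The division is exact. When n <= m and j <= \dim C the full space is one   *)
(* of the anticodes in the range, so that the default value of the minimum    *)
(* plays no role.                                                             *)
Definition gen_weight C (j : nat) : nat :=
  ((\big[minn/(\dim {: Mat})]_(A : {vspace Mat} |
      optimal_anticode A && (j <= \dim (A :&: C))%N) \dim A) %/ m)%N.

Definition BMD C (i : nat) : bool :=
  n%:Z - (dperp C)%:Z - (gen_weight C i)%:Z < 0.

Definition colsupp D : {vspace 'rV[F]_n} := (\sum_(M : Mat | M \in D) colsp M)%VS.
Definition rowsupp D : {vspace 'rV[F]_m} := (\sum_(M : Mat | M \in D) rowsp M)%VS.

Definition Acol C (j : nat) (W : {vspace 'rV[F]_n}) : nat :=
  #|[set D : {vspace Mat} | [&& (D <= C)%VS, \dim D == j & colsupp D == W]]|.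
Definition Arow C (j : nat) (W : {vspace 'rV[F]_m}) : nat :=
  #|[set D : {vspace Mat} | [&& (D <= C)%VS, \dim D == j & rowsupp D == W]]|.

(* Row spaces live in 'rV_m, which is 'rV_n only up to the equality n = m;    *)
(* hence the sum over the W of dimension w is split in two.                   *)
Definition Aw C (j w : nat) : rat :=
  if (n < m)%N then \sum_(W : {vspace 'rV[F]_n} | \dim W == w) (Acol C j W)%:R
  else 2%:R^-1 *
    (\sum_(W : {vspace 'rV[F]_n} | \dim W == w) (Acol C j W)%:R
     + \sum_(W : {vspace 'rV[F]_m} | \dim W == w) (Arow C j W)%:R).

Definition weight_enum C (j : nat) : {mpoly rat[2]} :=
  let X := 'X_ord0 in let Y := 'X_ord_max in
  \sum_(w < n.+1) Aw C j w *: (X ^+ (n - w) * Y ^+ w).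

(* Spans again only serve to get a {vspace _}: see mem_shortc and mem_shortr. *)
Definition shortc C (U : {vspace 'rV[F]_n}) : {vspace Mat} :=
  <<enum [pred M : Mat | (M \in C) && (colsp M <= U)%VS]>>%VS.
Definition shortr C (U : {vspace 'rV[F]_m}) : {vspace Mat} :=
  <<enum [pred M : Mat | (M \in C) && (rowsp M <= U)%VS]>>%VS.

Definition Bu C (j u : nat) : rat :=
  if (n < m)%N then
    \sum_(U : {vspace 'rV[F]_n} | \dim U == u) gauss #|F| (\dim (shortc C U)) j
  else 2%:R^-1 *
    (\sum_(U : {vspace 'rV[F]_n} | \dim U == u) gauss #|F| (\dim (shortc C U)) j
     + \sum_(U : {vspace 'rV[F]_m} | \dim U == u)
          gauss #|F| (\dim (shortr C U)) j).

Definition bu C (j : nat) (u : int) : rat :=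
  let d := gen_weight C j in
  if u < 0 then 0
  else if u <= n%:Z - (dperp C)%:Z - d%:Z then
    Bu C j (`|u| + d)%N / gauss #|F| n (u + d%:Z)
  else gauss #|F| ((\dim C)%:Z - m%:Z * (n%:Z - u - d%:Z)) j.

End Codes.

Section Membership.

Variables (F : finFieldType) (n m : nat).
Local Notation Mat := 'M[F]_(n, m).
Implicit Types (C : {vspace Mat}) (M N : Mat).

Lemma mem_span_enum (P : pred Mat) :
    P 0 -> (forall a M N, P M -> P N -> P (a *: M + N)) ->
  forall M, (M \in <<enum P>>%VS) = P M.
Proof.
move=> P0 PD M; apply/idP/idP => [|PM]; last by rewrite memv_span ?mem_enum.
rewrite -[enum P]/(val (in_tuple (enum P))) => /coord_span->.
apply: (big_ind P) => // [x y Px Py|i _]; first by rewrite -[x]scale1r PD.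
rewrite -[_ *: _]addr0 PD //.
have: (enum P)`_i \in enum P by apply: mem_nth.
by rewrite mem_enum.
Qed.

Lemma colspP M (U : {vspace 'rV[F]_n}) :
  reflect (forall j, (col j M)^T \in U) (colsp M <= U)%VS.
Proof.
apply: (iffP span_subvP) => [sMU j | MU _ /imageP[j _ ->]]; last exact: MU.
exact/sMU/image_f.
Qed.

Lemma rowspP M (U : {vspace 'rV[F]_m}) :
  reflect (forall i, row i M \in U) (rowsp M <= U)%VS.
Proof.
apply: (iffP span_subvP) => [sMU j | MU _ /imageP[j _ ->]]; last exact: MU.
exact/sMU/image_f.
Qed.

Lemma mem_dual C N :
  (N \in dual C) = [forall M in C, \tr (M *m N^T) == 0].
Proof.
rewrite /dual mem_span_enum //=.
  by apply/forall_inP => M _; rewrite trmx0 mulmx0 mxtrace0.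
move=> a M1 M2 /forall_inP M1C /forall_inP M2C; apply/forall_inP => M MC.
rewrite linearP mulmxDr -scalemxAr mxtraceD mxtraceZ.
by rewrite (eqP (M1C _ MC)) (eqP (M2C _ MC)) mulr0 addr0.
Qed.

Lemma mem_shortc C U M :
  (M \in shortc C U) = (M \in C) && (colsp M <= U)%VS.
Proof.
rewrite /shortc mem_span_enum //=.
  by rewrite mem0v; apply/colspP => j; rewrite !linear0 mem0v.
move=> a M1 M2 /andP[M1C /colspP M1U] /andP[M2C /colspP M2U].
apply/andP; split; first exact: memvD (memvZ a M1C) M2C.
apply/colspP => j; rewrite !linearP; exact: memvD (memvZ a (M1U j)) (M2U j).
Qed.

Lemma mem_shortr C U M :
  (M \in shortr C U) = (M \in C) && (rowsp M <= U)%VS.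
Proof.
rewrite /shortr mem_span_enum //=.
  by rewrite mem0v; apply/rowspP => j; rewrite linear0 mem0v.
move=> a M1 M2 /andP[M1C /rowspP M1U] /andP[M2C /rowspP M2U].
apply/andP; split; first exact: memvD (memvZ a M1C) M2C.
apply/rowspP => j; rewrite !linearP; exact: memvD (memvZ a (M1U j)) (M2U j).
Qed.

End Membership.

(* Main.v *)
(* For a support space U of dimension u, the matrices of C supported in U form
   C :&: S, where S, the space of all matrices supported in U, is an optimal
   anticode of dimension m u whose orthogonal has ranks at most n - u.  If
   u < d_j, then dim (C :&: S) < j by definition of d_j.  If d_i <= u, then
   n - u < d^perp since C is i-BMD, so no nonzero element of the dual of C is
   orthogonal to S; hence C + S is the full space and dim (C :&: S) is
   k - m (n - u).  As d_i <= d_j, these cases are exhaustive, and the number of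
   j-dimensional subcodes supported in U depends only on u; q-inversion then
   counts those whose support is exactly U.  The q-binomial theorem turns the
   resulting coefficients into the q-Bernstein polynomials. *)

Require Import Defs.
From mathcomp Require Import all_boot all_order all_algebra all_field.
From mathcomp Require Import mpoly.
From mathcomp Require Import zify ring.

Set Implicit Arguments.
Unset Strict Implicit.
Unset Printing Implicit Defensive.

Import Order.TTheory GRing.Theory Num.Theory.
Local Open Scope ring_scope.

(** * Gaussian binomials, the q-binomial theorem and q-inversion *)

(** This is the q-factorial without its denominators [q - 1], whose powers cancel in [gaussE]. *)
Definition qfact (q n : nat) : rat := \prod_(1 <= s < n.+1) (q%:R ^+ s - 1).

Lemma qfact0 q : qfact q 0 = 1.
Proof. exact: big_geq. Qed.

Lemma qfactS q n : qfact q n.+1 = qfact q n * (q%:R ^+ n.+1 - 1).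
Proof. by rewrite /qfact big_nat_recr. Qed.

Lemma qfact_neq0 q n : (1 < q)%N -> qfact q n != 0.
Proof.
move=> q_gt1; elim: n => [|n IHn]; first by rewrite qfact0 oner_eq0.
by rewrite qfactS mulf_neq0 // subr_eq0 gt_eqF // exprn_egt1 ?ltr1n.
Qed.

Lemma qfact_subn q n k : (k < n)%N ->
  qfact q (n - k) = qfact q (n - k.+1) * (q%:R ^+ (n - k) - 1).
Proof. by move/subnSK=> <-; rewrite qfactS. Qed.

Lemma gauss_small q (n k : nat) : (n < k)%N -> gauss q n k = 0.
Proof. by rewrite /gauss => lt_nk; rewrite lez_nat ltz_nat lt_nk orbT. Qed.

Lemma gauss0 q n : gauss q n 0 = 1.
Proof. by case: n. Qed.

Lemma gaussE q (n k : nat) : (1 < q)%N -> (k <= n)%N ->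
  gauss q n k = qfact q n / (qfact q k * qfact q (n - k)).
Proof.
move=> q_gt1 le_kn; have nz x : qfact q x != 0 by exact: qfact_neq0.
have ->: gauss q n k = gauss_prod q n k.
  rewrite /gauss lez_nat ltz_nat ltnNge le_kn /=.
  by case: k {le_kn} => [|k]; rewrite // /gauss_prod big_geq.
elim: k le_kn => [|k IHk] lt_kn.
  by rewrite subn0 /gauss_prod big_geq // qfact0 mul1r divff.
rewrite /gauss_prod big_nat_recr //= -/(gauss_prod q n k) IHk 1?ltnW //.
rewrite qfactS qfact_subn //.
have ->: n%:Z - k.+1%:Z + 1 = (n - k)%N%:Z by lia.
have nz1 : (q%:R ^+ (n - k) - 1 : rat) != 0.
  by rewrite subr_eq0 gt_eqF // exprn_egt1 ?ltr1n ?subn_eq0 -?ltnNge.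
have nz2 : (q%:R ^+ k.+1 - 1 : rat) != 0.
  by rewrite subr_eq0 gt_eqF // exprn_egt1 ?ltr1n.
rewrite -exprnP; field; rewrite ?nz //.
by rewrite nz1 nz2.
Qed.

Lemma gaussnn q (n : nat) : (1 < q)%N -> gauss q n n = 1.
Proof.
move=> q_gt1; rewrite gaussE // subnn qfact0 mulr1.
by rewrite divff ?qfact_neq0.
Qed.

Lemma gauss_Pascal q (n k : nat) : (1 < q)%N -> (k <= n)%N ->
  gauss q n.+1 k.+1 = gauss q n k.+1 + q%:R ^+ (n - k) * gauss q n k.
Proof.
move=> q_gt1; rewrite leq_eqVlt => /predU1P[->|lt_kn].
  (* The case [k = n] is apart: [gauss q n n.+1] is 0 by convention, outside the range of
     [gaussE]. *)
  by rewrite subnn mul1r (@gauss_small _ n) // !gaussnn // add0r.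
have nz x : qfact q x != 0 by exact: qfact_neq0.
have le_kn := ltnW lt_kn.
rewrite !gaussE // subSS qfactS (qfactS q k) qfact_subn //.
have nz1 s : (0 < s)%N -> (q%:R ^+ s - 1 : rat) != 0.
  by move=> s_gt0; rewrite subr_eq0 gt_eqF // exprn_egt1 ?ltr1n -?lt0n.
(* With a = n - k and b = k + 1, what remains is q^(a+b) - 1 = (q^a - 1) + q^a (q^b - 1) over a
   common denominator. *)
have ->: n.+1 = ((n - k) + k.+1)%N by lia.
have := nz1 (n - k)%N; have := nz1 k.+1 isT.
rewrite exprD => nzk nzn; field.
by rewrite nzk nzn ?subn_gt0 // !nz.
Qed.

(** Both sides are the q-multinomial coefficient with parts u, w - u and n - w. *)
Lemma gauss_trinomial q (n w u : nat) : (1 < q)%N -> (u <= w <= n)%N ->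
  gauss q n w * gauss q w u = gauss q n u * gauss q (n - u)%N (w - u)%N.
Proof.
move=> q_gt1 /andP[le_uw le_wn].
have nz x : qfact q x != 0 by exact: qfact_neq0.
rewrite !gaussE ?leq_sub2r // ?(leq_trans le_uw) //.
have ->: (n - u - (w - u) = n - w)%N by lia.
by field; rewrite !nz.
Qed.

(** Induction on n: multiplying by the last factor X - q^n Y turns the coefficients into the two
    terms of [gauss_Pascal]. A general algebra covers both polynomials and the rational
    specialization X = Y = 1. *)
Lemma q_binomial (A : comAlgType rat) q n (X Y : A) : (1 < q)%N ->
  \prod_(0 <= s < n) (X - q%:R ^+ s *: Y) =
  \sum_(t < n.+1) (gauss q n t * (-1) ^+ t * q%:R ^+ 'C(t, 2))
                    *: (X ^+ (n - t) * Y ^+ t).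
Proof.
move=> q_gt1; elim: n => [|n IHn].
  by rewrite big_geq // big_ord1 gauss0 !mul1r scale1r.
rewrite big_nat_recr //= {}IHn mulrBr !mulr_suml.
rewrite [RHS]big_ord_recl [in LHS]big_ord_recl /=.
rewrite -scalerAl [_ * Y ^+ 0 * X]mulrAC -exprSr !subn0 -addrA !gauss0.
congr (_ + _).
(* The added term t = n is zero, since [gauss q n n.+1] is; both sums now have the same range. *)
have -> : \sum_(t < n) gauss q n (bump 0 t) * (-1) ^+ bump 0 t
     * q%:R ^+ 'C(bump 0 t, 2) *: (X ^+ (n - bump 0 t) * Y ^+ bump 0 t) * X =
  \sum_(t < n.+1) gauss q n t.+1 * (-1) ^+ t.+1
     * q%:R ^+ 'C(t.+1, 2) *: (X ^+ (n - t) * Y ^+ t.+1).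
  rewrite big_ord_recr /= gauss_small // !mul0r scale0r addr0.
  apply: eq_bigr => t _; rewrite /bump leq0n add1n -scalerAl.
  by rewrite [_ * Y ^+ _ * X]mulrAC -exprSr subnSK.
rewrite -sumrB; apply: eq_bigr => t _.
have le_tn : (t <= n)%N by rewrite -ltnS.
rewrite /bump leq0n add1n subSS (gauss_Pascal q_gt1 le_tn).
rewrite -scalerAr -scalerAl scalerA -[_ * _ * Y]mulrA -exprSr -scalerBl.
congr (_ *: _).
have -> : q%:R ^+ n = q%:R ^+ (n - t) * q%:R ^+ t :> rat.
  by rewrite -exprD subnK.
rewrite binS bin1 exprD exprS; ring.
Qed.

(* The inverse of the transform f |-> (w |-> \sum_(u <= w) gauss q w u * f u). *)
Definition qinv (q w : nat) (f : nat -> rat) : rat :=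
  \sum_(u < w.+1) gauss q w u * (-1) ^+ (w - u) * q%:R ^+ 'C(w - u, 2) * f u.

(** At X = Y = 1 the factor s = 0 of the q-binomial product vanishes. *)
Lemma alternating_gauss q n : (1 < q)%N -> (0 < n)%N ->
  \sum_(t < n.+1) gauss q n t * (-1) ^+ t * q%:R ^+ 'C(t, 2) = 0.
Proof.
move=> q_gt1; case: n => // n _.
have /esym := @q_binomial rat^o q n.+1 1 1 q_gt1.
rewrite big_nat_recl // expr0 scale1r subrr mul0r => {2}<-.
by apply: eq_bigr => t _; rewrite !expr1n mulr1 /GRing.scale /= mulr1.
Qed.

(** A range independent of w allows double sums to be exchanged. *)
Lemma qinvE q u w f : (w <= u)%N ->
  qinv q w f = \sum_(v < u.+1)
    gauss q w v * (-1) ^+ (w - v) * q%:R ^+ 'C(w - v, 2) * f v.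
Proof.
move=> le_wu; rewrite -!(big_mkord xpredT
  (fun v => gauss q w v * (-1) ^+ (w - v) * q%:R ^+ 'C(w - v, 2) * f v)).
rewrite [RHS](big_cat_nat (n := w.+1)) //= big_mkord.
rewrite [X in _ + X]big_nat [X in _ + X]big1 ?addr0 // => v /andP[lt_wv _].
by rewrite gauss_small // !mul0r.
Qed.

(** After exchanging the sums, [gauss_trinomial] turns the coefficient of f v into [gauss q u v]
    times the alternating sum for u - v, which vanishes unless v = u. *)
Lemma qinvK q u (f : nat -> rat) : (1 < q)%N ->
  \sum_(w < u.+1) gauss q u w * qinv q w f = f u.
Proof.
move=> q_gt1.
transitivity (\sum_(w < u.+1) \sum_(v < u.+1) gauss q u w *
    (gauss q w v * (-1) ^+ (w - v) * q%:R ^+ 'C(w - v, 2) * f v)).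
  apply: eq_bigr => w _; have le_wu : (w <= u)%N by rewrite -ltnS.
  by rewrite (qinvE _ _ le_wu) mulr_sumr.
rewrite exchange_big big_ord_recr /= [X in _ + X]big_ord_recr /=.
rewrite [X in _ + (X + _)]big1 ?add0r => [|w _]; last first.
  by rewrite (gauss_small _ (ltn_ord w)) !(mul0r, mulr0).
rewrite subnn !gaussnn // !mul1r big1 ?add0r // => v _.
move: (nat_of_ord v) (ltn_ord v) => {}v lt_vu.
transitivity (gauss q u v * f v * \sum_(t < (u - v).+1)
    gauss q (u - v)%N t * (-1) ^+ t * q%:R ^+ 'C(t, 2)); last first.
  by rewrite alternating_gauss ?subn_gt0 // mulr0.
rewrite -(big_mkord xpredT (fun w => gauss q u w *
   (gauss q w v * (-1) ^+ (w - v) * q%:R ^+ 'C(w - v, 2) * f v))).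
rewrite (big_cat_nat (n := v)) //=; last by rewrite ltnW // ltnW.
rewrite big_nat big1 ?add0r => [|w /= lt_wv]; last first.
  by rewrite (gauss_small _ lt_wv) !(mul0r, mulr0).
rewrite -{1}[v]add0n big_addn subSn 1?ltnW // mulr_sumr big_mkord.
apply: eq_bigr => t _; rewrite !mulrA.
rewrite gauss_trinomial ?addnK; first by ring.
  by [].
by rewrite leq_addl /=; have := ltn_ord t; lia.
Qed.

(** * Counting free tuples and subspaces *)

Lemma card_cons_tuple (T : finType) n (P : pred (n.+1.-tuple T)) :
  #|P| = (\sum_(t : n.-tuple T) #|[pred x | P (cons_tuple x t)]|)%N.
Proof.
rewrite -sum1_card (eq_bigr (fun t : n.-tuple T =>
  \sum_(x | P (cons_tuple x t)) 1)%N) => [|t _]; last by rewrite -sum1_card.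
rewrite pair_big_dep /=.
rewrite (reindex (fun p : n.-tuple T * T => cons_tuple p.2 p.1)) //=.
exists (fun t => (behead_tuple t, thead t)) => [[t x] _ | t _] /=.
  by rewrite theadE; congr (_, _); apply: val_inj.
by rewrite [RHS]tuple_eta.
Qed.

(** For q the order of the field, this is the number of free j-tuples in a space of dimension d; it
    is 0 when d < j, through the factor s = d. *)
Definition qfall (q d j : nat) : rat := \prod_(s < j) (q%:R ^+ d - q%:R ^+ s).

Lemma qfall_eq0 q d j : (d < j)%N -> qfall q d j = 0.
Proof.
by move=> lt_dj; rewrite /qfall (bigD1 (Ordinal lt_dj)) //= subrr mul0r.
Qed.

Lemma qfall_neq0 q d : (1 < q)%N -> qfall q d d != 0.
Proof.
move=> q_gt1; apply/prodf_neq0 => s _.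
by rewrite subr_eq0 -!natrX eqr_nat eqn_exp2l // gtn_eqF.
Qed.

Lemma qfallE q d j : (1 < q)%N -> (j <= d)%N ->
  qfall q d j = q%:R ^+ 'C(j, 2) * qfact q d / qfact q (d - j).
Proof.
move=> q_gt1; have nz x : qfact q x != 0 by exact: qfact_neq0.
rewrite /qfall; elim: j => [|j IHj] lt_jd.
  by rewrite big_ord0 subn0 mul1r divff.
rewrite big_ord_recr /= IHj 1?ltnW // (qfact_subn _ lt_jd) binS bin1 exprD.
have nz1 : (q%:R ^+ (d - j) - 1 : rat) != 0.
  by rewrite subr_eq0 gt_eqF // exprn_egt1 ?ltr1n // -lt0n subn_gt0.
have -> : q%:R ^+ d = q%:R ^+ (d - j) * q%:R ^+ j :> rat.
  by rewrite -exprD subnK // ltnW.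
by field; rewrite nz nz1.
Qed.

Lemma gauss_qfall q (d j : nat) : (1 < q)%N ->
  gauss q d j * qfall q j j = qfall q d j.
Proof.
move=> q_gt1; have nz x : qfact q x != 0 by exact: qfact_neq0.
have [lt_dj|le_jd] := ltnP d j; first by rewrite gauss_small // mul0r qfall_eq0.
rewrite gaussE // !qfallE // subnn qfact0.
by field; rewrite !nz.
Qed.

Section SubspaceCount.

Variables (F : finFieldType) (n p : nat).
Local Notation E := 'M[F]_(n, p).
Local Notation q := #|F|.
Implicit Types (U D : {vspace E}).

Let q_gt1 : (1 < q)%N := finNzRing_gt1 F.

(** A free j-tuple in U extends by exactly the vectors of U outside its span, which leaves q^(dim U)
    - q^j choices. *)
Lemma card_free_tuple U j :
  #|[pred X : j.-tuple E | free X && (<<X>> <= U)%VS]|%:R = qfall q (\dim U) j.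
Proof.
elim: j => [|j IHj].
  rewrite /qfall big_ord0 (eq_card (B := predT)) ?card_tuple // => X.
  by rewrite !inE tuple0 nil_free span_nil sub0v.
rewrite /qfall big_ord_recr /= -/(qfall _ _ _) -IHj card_cons_tuple.
rewrite (bigID (fun X : j.-tuple E => free X && (<<X>> <= U)%VS)) /=.
rewrite [X in (_ + X)%N]big1 ?addn0 => [|X bad_X]; last first.
  apply: eq_card0 => x; rewrite !inE /= free_cons span_cons subv_add.
  by apply: contraNF bad_X => /andP[/andP[_ ->] /andP[_ ->]].
rewrite natr_sum -sum1_card natr_sum mulr_suml; apply: eq_bigr => X.
move=> /andP[freeX sXU]; rewrite mul1r.
have dimX : \dim <<X>> = j by rewrite (eqP freeX) size_tuple.
have := cardID (mem <<X>>%VS) (mem U).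
rewrite (eq_card (A := [predI mem U & mem <<X>>%VS]) (B := mem <<X>>%VS)).
  2: by move=> x; rewrite !inE andb_idl // => /(subvP sXU).
rewrite !card_vspace dimX -!natrX => <-; rewrite natrD addrAC subrr add0r.
congr (_%:R); apply: eq_card => x; rewrite !inE /= free_cons span_cons subv_add.
by rewrite freeX sXU !andbT.
Qed.

(** Free j-tuples in U are grouped by their span: each subspace of dimension j has [qfall q j j]
    ordered bases. *)
Lemma card_subspaces U j :
  #|[set D : {vspace E} | (D <= U)%VS && (\dim D == j)]|%:R
    = gauss q (\dim U) j.
Proof.
apply: (mulIf (qfall_neq0 j q_gt1)); rewrite gauss_qfall // -card_free_tuple.
rewrite -[in RHS]sum1_card (partition_big (fun X : j.-tuple E => <<X>>%VS)
  (mem [set D : {vspace E} | (D <= U)%VS && (\dim D == j)])) /=; last first.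
  by move=> X /andP[freeX sXU]; rewrite inE sXU (eqP freeX) size_tuple /=.
rewrite natr_sum -[in LHS]sum1_card natr_sum mulr_suml; apply: eq_bigr => D.
rewrite inE => /andP[sDU /eqP dimD]; rewrite mul1r -{1}dimD -card_free_tuple.
rewrite sum1_card; congr (_%:R); apply: eq_card => X; rewrite !inE /=.
apply/andP/andP => [[freeX sXD]|[/andP[freeX _] /eqP->]] //.
have eqXD : <<X>>%VS == D.
  by rewrite eqEdim sXD (eqP freeX) size_tuple dimD /=.
by rewrite inE /= freeX (eqP eqXD) sDU.
Qed.

End SubspaceCount.

(** * From inverted sums to q-Bernstein polynomials *)

Lemma sum_ord_shift (V : nmodType) (n u : nat) (H : nat -> V) :
  (u <= n)%N -> (forall w, (w < u)%N -> H w = 0) ->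
  \sum_(w < n.+1) H w = \sum_(t < (n - u).+1) H (t + u)%N.
Proof.
move=> le_un H0; rewrite -(big_mkord xpredT H) (big_cat_nat (n := u)) //=.
  rewrite big_nat big1 ?add0r => [|w /= /H0 //].
  by rewrite -{1}[u]add0n big_addn subSn // big_mkord.
exact: leqW.
Qed.

(** For fixed u, [gauss_trinomial] extracts [gauss q n u] from the sum over w, and the remaining sum
    over t = w - u is the q-binomial expansion of the product in [bernstein q n u]. *)
Lemma bernstein_inversion q n (f : nat -> rat) : (1 < q)%N ->
  \sum_(w < n.+1) (gauss q n w * qinv q w f)
     *: ('X_ord0 ^+ (n - w) * 'X_ord_max ^+ w : {mpoly rat[2]}) =
  \sum_(u < n.+1) f u *: bernstein q n u.
Proof.
move=> q_gt1; set X : {mpoly rat[2]} := 'X_ord0.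
set Y : {mpoly rat[2]} := 'X_ord_max.
pose G (u w : nat) := (gauss q n w * (gauss q w u * (-1) ^+ (w - u)
                  * q%:R ^+ 'C(w - u, 2) * f u)) *: (X ^+ (n - w) * Y ^+ w).
transitivity (\sum_(w < n.+1) \sum_(u < n.+1) G u w).
  apply: eq_bigr => w _; have le_wn : (w <= n)%N by rewrite -ltnS.
  by rewrite (qinvE _ _ le_wn) mulr_sumr scaler_suml.
rewrite exchange_big /=; apply: eq_bigr => u _.
have le_un : (u <= n)%N by rewrite -ltnS.
rewrite (sum_ord_shift le_un) => [|w lt_wu]; last first.
  by rewrite /G (gauss_small q lt_wu) !(mul0r, mulr0) scale0r.
rewrite /bernstein -/X -/Y (q_binomial _ _ _ q_gt1) mulr_sumr scaler_sumr.
rewrite scaler_sumr; apply: eq_bigr => t _.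
have le_tnu : (t <= n - u)%N by rewrite -ltnS.
rewrite /G -scalerAr !scalerA addnK; congr (_ *: _).
  rewrite !mulrA gauss_trinomial ?addnK //; first by ring.
  by rewrite leq_addl /=; lia.
by rewrite mulrCA -exprD -subnDA [(u + t)%N]addnC.
Qed.

(** * Subcodes with prescribed support *)

Section Support.

Variables (F : finFieldType) (n m p : nat).
Local Notation E := 'M[F]_(n, m).
Local Notation V := 'rV[F]_p.
Local Notation q := #|F|.
Implicit Types (C D : {vspace E}) (U W : {vspace V}).

Let q_gt1 : (1 < q)%N := finNzRing_gt1 F.

Lemma sum_subspaces W (g : nat -> rat) :
  \sum_(U : {vspace V} | (U <= W)%VS) g (\dim U) =
  \sum_(u < (\dim W).+1) gauss q (\dim W) u * g u.
Proof.
rewrite (partition_big (fun U => inord (\dim U) : 'I_(\dim W).+1) xpredT) //=.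
apply: eq_bigr => u _; rewrite -card_subspaces.
rewrite (eq_bigl (fun U => U \in [set D | (D <= W)%VS && (\dim D == u)])).
  rewrite (eq_bigr (fun=> g u)) => [|U]; last by rewrite inE => /andP[_ /eqP->].
  by rewrite sumr_const mulr_natl.
move=> U; rewrite inE; apply: andb_id2l => sUW.
by rewrite -val_eqE /= inordK // ltnS dimvS.
Qed.

Lemma sum_dim w (g : nat -> rat) :
  \sum_(U : {vspace V} | \dim U == w) g (\dim U) = gauss q p w * g w.
Proof.
transitivity (gauss q (\dim {: V}) w * g w).
  2: by rewrite dimvf /dim /= mul1n.
rewrite -card_subspaces (eq_bigr (fun=> g w)) => [|U /eqP-> //].
rewrite (eq_bigl (fun U => U \in [set D | (D <= {:V})%VS && (\dim D == w)])).
  by rewrite sumr_const mulr_natl.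
by move=> U; rewrite inE subvf.
Qed.

Variables (C : {vspace E}) (s : E -> {vspace V}) (S : {vspace V} -> {vspace E}).
Hypothesis memS : forall U M, (M \in S U) = (M \in C) && (s M <= U)%VS.

Let supp D : {vspace V} := (\sum_(M : E | M \in D) s M)%VS.

(** The map [s] stands for [colsp] or [rowsp], and [S] for the matching shortening, so that columns
    and rows are treated at once. *)
Lemma sub_short D U : (D <= S U)%VS = (D <= C)%VS && (supp D <= U)%VS.
Proof.
apply/subvP/andP => [sDS | [/subvP sDC /subv_sumP sDU] M DM].
  split; first by apply/subvP => M /sDS; rewrite memS => /andP[].
  by apply/subv_sumP => M /sDS; rewrite memS => /andP[].
by rewrite memS sDC // sDU.
Qed.

(** Grouping the j-dimensional subspaces of [S W] by support gives f (dim W) as the sum of the exact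
    counts over U <= W. By [qinvK] the claimed values have the same sums, so strong induction on dim
    W cancels all proper U. *)
Lemma card_support (j : nat) (f : nat -> rat) :
  (forall U, gauss q (\dim (S U)) j = f (\dim U)) ->
  forall W, #|[set D : {vspace E} | [&& (D <= C)%VS, \dim D == j
                                     & supp D == W]]|%:R = qinv q (\dim W) f.
Proof.
move=> gaussS W; pose A U :=
  #|[set D : {vspace E} | [&& (D <= C)%VS, \dim D == j & supp D == U]]|.
rewrite -/(A W).
have [d] := ubnP (\dim W); elim: d W => // d IHd W; rewrite ltnS => le_Wd.
have sumA : \sum_(U : {vspace V} | (U <= W)%VS) (A U)%:R = f (\dim W) :> rat.
  rewrite -gaussS -card_subspaces -sum1_card -natr_sum; congr (_%:R).
  rewrite (partition_big supp (fun U => (U <= W)%VS)) /= => [|D]; last first.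
    by rewrite inE sub_short => /andP[/andP[]].
  apply: eq_bigr => U sUW; rewrite /A -sum1_card; apply: eq_bigl => D.
  rewrite !inE sub_short; case: (supp D =P U) => [->|_]; last by rewrite !andbF.
  by rewrite sUW !andbT.
move: sumA; rewrite -(qinvK _ f q_gt1) -(sum_subspaces W (fun u => qinv q u f)).
rewrite (bigD1 W) //= [RHS](bigD1 W) //=.
rewrite [X in _ + X](eq_bigr (fun U : {vspace V} => qinv q (\dim U) f)).
  exact: addIr.
move=> U /andP[sUW neUW]; apply: IHd; apply: leq_trans le_Wd.
by rewrite ltn_neqAle dimvS // andbT (dimv_leqif_eq sUW).
Qed.

End Support.

(** * Subspaces as row spaces of matrices *)

Section RowBasis.

Variables (F : fieldType) (p : nat) (U : {vspace 'rV[F]_p}).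

Definition vbasis_mx : 'M[F]_(\dim U, p) := \matrix_(i < \dim U) (vbasis U)`_i.

Lemma memv_vbasis_mx v : (v \in U) = (v <= vbasis_mx)%MS.
Proof.
apply/idP/submxP => [vU | [x ->]].
  exists (\row_i coord (vbasis U) i v).
  rewrite mulmx_sum_row [LHS](coord_vbasis vU).
  by apply: eq_bigr => i _; rewrite mxE rowK.
rewrite mulmx_sum_row memv_suml // => i _.
by rewrite rowK memvZ // vbasis_mem // mem_nth // size_tuple.
Qed.

Lemma row_free_vbasis_mx : row_free vbasis_mx.
Proof.
apply: inj_row_free => x; rewrite mulmx_sum_row => x0; apply/rowP => i.
rewrite mxE; move/freeP: (basis_free (vbasisP U)); apply.
by rewrite -[RHS]x0; apply: eq_bigr => k _; rewrite rowK.
Qed.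

End RowBasis.

Lemma dim_injective_image (F : fieldType) (aT rT : vectType F)
    (f : {linear aT -> rT}) (V : {vspace rT}) :
  injective f -> (forall y, reflect (exists x, y = f x) (y \in V)) ->
  \dim V = dim aT.
Proof.
move=> f_inj memV; have -> : V = limg (linfun f).
  apply/vspaceP => y; apply/memV/memv_imgP => [[x ->]|[x _ ->]].
    by exists x; rewrite ?memvf // lfunE.
  by exists x; rewrite lfunE.
rewrite limg_dim_eq ?dimvf //; apply/eqP; rewrite capfv.
by apply/lker0P => x y; rewrite !lfunE => /f_inj.
Qed.

(** * Trace duality and generalized weights *)

Section Orthogonality.

Variables (F : finFieldType) (n m : nat).
Local Notation E := 'M[F]_(n, m).
Implicit Types (C S W : {vspace E}) (M N : E).

Lemma trace_mul_eq0 a b (A : 'M[F]_(a, b)) :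
  (forall X : 'M_(b, a), \tr (A *m X) = 0) -> A = 0.
Proof.
move=> A0; apply/matrixP => i j; rewrite !mxE -[RHS](A0 (delta_mx j i)).
rewrite /mxtrace (bigD1 i) //= big1 ?addr0 => [|k /negPf neki].
  rewrite !mxE (bigD1 j) //= !mxE !eqxx mulr1 big1 ?addr0 // => l /negPf nelj.
  by rewrite !mxE nelj mulr0.
by rewrite mxE big1 // => l _; rewrite !mxE neki andbF mulr0.
Qed.

(** The complementary projection [g] kills W and is nonzero at some v outside W. Some entry of [g v]
    is nonzero, so that entry of [g] is a nonzero functional vanishing on W; [N] collects its values
    on the elementary matrices. *)
Lemma proper_orthogonal W : W != fullv ->
  exists2 N, N != 0 & forall M, M \in W -> \tr (M *m N^T) = 0.
Proof.
move=> neWT; have /subvPn[v _ vNW] : ~~ (fullv <= W)%VS.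
  by apply: contra neWT => sTW; rewrite eqEsubv subvf.
pose g M := M - projv W M.
have g_lin a x y : g (a *: x + y) = a *: g x + g y.
  by rewrite /g linearP opprD addrACA scalerBr.
have gv0 : g v != 0.
  by apply: contra vNW; rewrite subr_eq0 => /eqP->; apply: memv_proj.
have /existsP[i0 /existsP[j0 gij]] : [exists i, exists j, g v i j != 0].
  apply: contraNT gv0 => /existsPn g0; apply/eqP/matrixP => i j.
  by have /existsPn/(_ j)/negPn/eqP-> := g0 i; rewrite mxE.
pose N := \matrix_(i, j) g (delta_mx i j) i0 j0.
have gN M : g M i0 j0 = \tr (M *m N^T).
  rewrite [in LHS](matrix_sum_delta M) /mxtrace.
  transitivity (\sum_i \sum_j M i j * g (delta_mx i j) i0 j0); last first.
    by apply: eq_bigr => i _; rewrite mxE; apply: eq_bigr => j _; rewrite !mxE.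
  have gsum I r (f : I -> E) : g (\sum_(i <- r) f i) = \sum_(i <- r) g (f i).
    by rewrite /g linear_sum sumrB.
  rewrite gsum summxE; apply: eq_bigr => i _.
  rewrite gsum summxE; apply: eq_bigr => j _.
  by rewrite /g linearZ -scalerBr mxE.
exists N.
  by apply: contraNneq gij => N0; rewrite gN N0 trmx0 mulmx0 mxtrace0.
by move=> M MW; rewrite -gN /g projv_id // subrr mxE.
Qed.

Lemma dperp_le_rank C N : N \in dual C -> N != 0 -> (dperp C <= \rank N)%N.
Proof.
move=> NC N0; rewrite /dperp (eq_bigr (fun N : E => \rank N)) //.
by rewrite -minEnat (bigminD1 N) ?NC // minEnat geq_minl.
Qed.

(** If C + S were proper, a nonzero N orthogonal to both would have rank at least [dperp C] and at
    most r. So C + S is the full space, and the dimension formula applies. *)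
Lemma dim_cap_orthogonal C S r :
  (forall N, (forall M, M \in S -> \tr (M *m N^T) = 0) -> (\rank N <= r)%N) ->
  (r < dperp C)%N -> (\dim (C :&: S) + n * m = \dim C + \dim S)%N.
Proof.
move=> rankS lt_r; have <- : \dim {: E} = (n * m)%N by rewrite dimvf.
rewrite -(dimv_sum_cap C S) addnC; congr (\dim _ + _)%N; apply/esym/eqP.
apply: contraLR lt_r => /proper_orthogonal[N N0 orthN]; rewrite -leqNgt.
apply: leq_trans (rankS N _); last first.
  by move=> M MS; apply: orthN; rewrite memvE (subv_trans _ (addvSr _ _)).
apply: dperp_le_rank N0; rewrite mem_dual; apply/forall_inP => M MC.
by apply/eqP/orthN; rewrite memvE (subv_trans _ (addvSl _ _)).
Qed.

Lemma gen_weight_homo C i j :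
  (i <= j)%N -> (gen_weight C i <= gen_weight C j)%N.
Proof.
move=> le_ij; apply: leq_div2r; rewrite -minEnat.
apply: (@sub_bigmin _ nat) => A /andP[-> /(leq_trans le_ij)] //.
Qed.

Lemma gen_weight_le C A j : optimal_anticode A -> (j <= \dim (A :&: C))%N ->
  (gen_weight C j <= \dim A %/ m)%N.
Proof.
move=> optA le_j; apply: leq_div2r; rewrite -minEnat (bigminD1 A) ?optA //.
by rewrite minEnat geq_minl.
Qed.

Lemma optimal_anticodeP A d M : \dim A = (m * d)%N ->
  (forall N, N \in A -> (\rank N <= d)%N) -> M \in A -> \rank M = d ->
  optimal_anticode A.
Proof.
move=> dimA rankA MA rankM; rewrite /optimal_anticode dimA; apply/eqP.
congr (_ * _)%N; apply/eqP; rewrite eqn_leq; apply/andP; split.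
  by rewrite -rankM (leq_bigmax_cond M).
exact/bigmax_leqP.
Qed.

End Orthogonality.

(** * Anticodes of matrices with column or row space in U *)

Section ColumnAnticode.

Variables (F : finFieldType) (n m : nat) (U : {vspace 'rV[F]_n}).
Local Notation E := 'M[F]_(n, m).
Local Notation B := (vbasis_mx U).
Local Notation S := (shortc (fullv : {vspace E}) U).

Lemma mem_colS M : reflect (exists X, M = (X *m B)^T) (M \in S).
Proof.
rewrite mem_shortc memvf /=.
apply: (iffP (colspP M U)) => [MU | [X ->] j].
  have /submxP[X eqM] : (M^T <= B)%MS.
    by apply/row_subP => j; rewrite -tr_col -memv_vbasis_mx.
  by exists X; rewrite -eqM trmxK.
by rewrite memv_vbasis_mx tr_col trmxK row_mul submxMl.
Qed.

Lemma dim_colS : \dim S = (m * \dim U)%N.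
Proof.
rewrite (dim_injective_image (f := trmx \o mulmxr B)) // => [X Y /=|M].
  by move/trmx_inj/(row_free_inj (row_free_vbasis_mx U)).
exact: mem_colS.
Qed.

(** Rank [\dim U] is attained because [\dim U <= n <= m]: the m by [\dim U] partial identity then
    has full column rank. *)
Lemma optimal_colS : (n <= m)%N -> optimal_anticode S.
Proof.
move=> le_nm; have rankB : \rank B = \dim U := eqP (row_free_vbasis_mx U).
apply: (@optimal_anticodeP _ _ _ _ (\dim U) (pid_mx (\dim U) *m B)^T).
- exact: dim_colS.
- by move=> _ /mem_colS[X ->]; rewrite mxrank_tr -[leqRHS]rankB mxrankM_maxr.
- by apply/mem_colS; exists (pid_mx (\dim U)).
rewrite mxrank_tr mxrankMfree ?row_free_vbasis_mx // rank_pid_mx //.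
by rewrite -rankB (leq_trans (rank_leq_col _)).
Qed.

(** Orthogonality to every (X B)^T forces B N = 0 by nondegeneracy of the trace, and B has rank
    [\dim U]. *)
Lemma rank_orthogonal_colS (N : E) :
  (forall M, M \in S -> \tr (M *m N^T) = 0) -> (\rank N <= n - \dim U)%N.
Proof.
move=> orthN; have rankB : \rank B = \dim U := eqP (row_free_vbasis_mx U).
rewrite leq_subRL -rankB ?rank_leq_col //; apply: mulmx0_rank_max.
apply: trace_mul_eq0 => X; rewrite mxtrace_mulC mulmxA mxtrace_mulC -mxtrace_tr.
by rewrite trmx_mul; apply: orthN; apply/mem_colS; exists X.
Qed.

End ColumnAnticode.

Section RowAnticode.

Variables (F : finFieldType) (n : nat) (U : {vspace 'rV[F]_n}).
Local Notation E := 'M[F]_n.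
Local Notation B := (vbasis_mx U).
Local Notation S := (shortr (fullv : {vspace E}) U).

Lemma mem_rowS M : reflect (exists X, M = X *m B) (M \in S).
Proof.
rewrite mem_shortr memvf /=.
apply: (iffP (rowspP M U)) => [MU | [X ->] j].
  by apply/submxP/row_subP => j; rewrite -memv_vbasis_mx.
by rewrite memv_vbasis_mx row_mul submxMl.
Qed.

Lemma dim_rowS : \dim S = (n * \dim U)%N.
Proof.
rewrite (dim_injective_image (f := mulmxr B)) // => [X Y /=|M].
  exact: (row_free_inj (row_free_vbasis_mx U)).
exact: mem_rowS.
Qed.

Lemma optimal_rowS : optimal_anticode S.
Proof.
have rankB : \rank B = \dim U := eqP (row_free_vbasis_mx U).
apply: (@optimal_anticodeP _ _ _ _ (\dim U) (pid_mx (\dim U) *m B)).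
- exact: dim_rowS.
- by move=> _ /mem_rowS[X ->]; rewrite -[leqRHS]rankB mxrankM_maxr.
- by apply/mem_rowS; exists (pid_mx (\dim U)).
rewrite mxrankMfree ?row_free_vbasis_mx // rank_pid_mx //.
by rewrite -rankB rank_leq_col.
Qed.

(** As for columns, with B N^T = 0 in place of B N = 0. *)
Lemma rank_orthogonal_rowS (N : E) :
  (forall M, M \in S -> \tr (M *m N^T) = 0) -> (\rank N <= n - \dim U)%N.
Proof.
move=> orthN; have rankB : \rank B = \dim U := eqP (row_free_vbasis_mx U).
rewrite leq_subRL -rankB ?rank_leq_col // -(mxrank_tr N).
apply: mulmx0_rank_max.
apply: trace_mul_eq0 => X; rewrite mxtrace_mulC mulmxA.
by apply: orthN; apply/mem_rowS; exists X.
Qed.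

End RowAnticode.

(** * Moments and weight distribution of an i-BMD code *)

Lemma exists_subspace (F : fieldType) (vT : vectType F) u :
  (u <= dim vT)%N -> exists U : {vspace vT}, \dim U = u.
Proof.
move=> le_u; have: free (vbasis {: vT}) := basis_free (vbasisP _).
rewrite -(cat_take_drop u (vbasis _)) => /catl_free free_take.
exists <<take u (vbasis {: vT})>>%VS.
by rewrite (eqP free_take) size_takel // size_tuple dimvf.
Qed.

Section BMD.

Variables (F : finFieldType) (n m i j : nat) (C : {vspace 'M[F]_(n, m)}).
Hypotheses (n_ge2 : (2 <= n)%N) (le_nm : (n <= m)%N).
Hypotheses (C_BMD : BMD C i) (le_ij : (i <= j)%N).
Local Notation E := 'M[F]_(n, m).
Local Notation q := #|F|.

Definition moment (u : nat) : rat :=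
  gauss q ((\dim C)%:Z - m%:Z * (n%:Z - u%:Z)) j.

(** The cut-off is explicit because below d_j the top argument in [moment] may be negative, where
    [gauss] need not vanish. *)
Definition short_moment (u : nat) : rat :=
  if (gen_weight C j <= u)%N then moment u else 0.

Lemma gauss_cap_anticode (S : {vspace E}) u : (u <= n)%N ->
    \dim S = (m * u)%N -> optimal_anticode S ->
    (forall N, (forall M, M \in S -> \tr (M *m N^T) = 0) ->
       (\rank N <= n - u)%N) ->
  gauss q (\dim (C :&: S)) j = short_moment u /\
  ((gen_weight C i <= u)%N -> gauss q (\dim (C :&: S)) j = moment u).
Proof.
move=> le_un dimS optS rankS.
have m_gt0 : (0 < m)%N by apply: leq_trans le_nm; apply: ltnW.
have moment_cap : (gen_weight C i <= u)%N ->
    gauss q (\dim (C :&: S)) j = moment u.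
  move=> le_du; rewrite /moment; congr (gauss _ _ _).
  have lt_dperp : (n - u < dperp C)%N by move: C_BMD; rewrite /BMD; lia.
  by have := dim_cap_orthogonal rankS lt_dperp; rewrite dimS; lia.
split; last exact: moment_cap.
rewrite /short_moment; case: leqP => [le_du|lt_ud].
  by apply/moment_cap/(leq_trans _ le_du)/gen_weight_homo.
rewrite gauss_small // ltnNge capvC; apply: contraL lt_ud => le_j.
by rewrite -leqNgt; have := gen_weight_le optS le_j; rewrite dimS mulKn.
Qed.

Lemma gauss_shortc (U : {vspace 'rV[F]_n}) :
  gauss q (\dim (shortc C U)) j = short_moment (\dim U) /\
  ((gen_weight C i <= \dim U)%N ->
   gauss q (\dim (shortc C U)) j = moment (\dim U)).
Proof.
have -> : shortc C U = (C :&: shortc fullv U)%VS.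
  by apply/vspaceP => M; rewrite memv_cap !mem_shortc memvf.
apply: gauss_cap_anticode.
- by rewrite (leq_trans (dimvS (subvf U))) // dimvf /dim /= mul1n.
- exact: dim_colS.
- exact: optimal_colS.
- exact: rank_orthogonal_colS.
Qed.

(** Both are the value of [gauss] at the same shortened code, for any U of dimension u. In
    particular [moment] vanishes for d_i <= u < d_j, which is why a sum may start at either
    weight. *)
Lemma short_momentE u : (gen_weight C i <= u)%N -> (u <= n)%N ->
  short_moment u = moment u.
Proof.
move=> le_du le_un.
have [|U dimU] := @exists_subspace F 'rV[F]_n u; first by rewrite /dim /= mul1n.
by have [] := gauss_shortc U; rewrite dimU => -> ->.
Qed.

(** The choice d = d_j serves the weight distribution and d = d_i the enumerator; a general module
    of values covers rationals and polynomials. *)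
Lemma sum_short_moment (V : lmodType rat) d w (G : nat -> V) :
    (w <= n)%N -> d = gen_weight C i \/ d = gen_weight C j ->
  \sum_(d <= u < w.+1) moment u *: G u =
  \sum_(u < w.+1) short_moment u *: G u.
Proof.
move=> le_wn d_ij; rewrite big_geq_mkord.
rewrite [RHS](bigID (fun u : 'I__ => (d <= u)%N)) /=.
have le_dij := gen_weight_homo C le_ij.
rewrite [X in _ + X]big1 ?addr0 => [|u]; last first.
  rewrite -ltnNge /short_moment => lt_ud.
  have lt_uj : (u < gen_weight C j)%N.
    by case: d_ij lt_ud => -> // /leq_trans; apply.
  by rewrite leqNgt lt_uj scale0r.
apply: eq_bigr => u le_du; rewrite short_momentE //.
  by case: d_ij le_du => ->; [|exact: leq_trans].
by apply: leq_trans le_wn; rewrite -ltnS.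
Qed.

Lemma sum_Acol w : \sum_(W : {vspace 'rV[F]_n} | \dim W == w) (Acol C j W)%:R =
  gauss q n w * qinv q w short_moment.
Proof.
rewrite -(@sum_dim F n w (fun u => qinv q u short_moment)).
apply: eq_bigr => W _.
by apply: (card_support (mem_shortc C)) => U; case: (gauss_shortc U).
Qed.

End BMD.

Lemma sum_Arow (F : finFieldType) n i j (C : {vspace 'M[F]_n}) w :
    (2 <= n)%N -> BMD C i -> (i <= j)%N ->
  \sum_(W : {vspace 'rV[F]_n} | \dim W == w) (Arow C j W)%:R =
  gauss #|F| n w * qinv #|F| w (short_moment j C).
Proof.
move=> n_ge2 C_BMD le_ij.
rewrite -(@sum_dim F n w (fun u => qinv #|F| u (short_moment j C))).
apply: eq_bigr => W _.
apply: (card_support (mem_shortr C)) => U.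
have -> : shortr C U = (C :&: shortr fullv U)%VS.
  by apply/vspaceP => M; rewrite memv_cap !mem_shortr memvf.
apply: (gauss_cap_anticode n_ge2 (leqnn n) C_BMD le_ij _ _ _ _).1.
- by rewrite (leq_trans (dimvS (subvf U))) // dimvf /dim /= mul1n.
- exact: dim_rowS.
- exact: optimal_rowS.
- exact: rank_orthogonal_rowS.
Qed.

Lemma Aw_qinv (F : finFieldType) n m i j (C : {vspace 'M[F]_(n, m)}) w :
    (2 <= n)%N -> (n <= m)%N -> BMD C i -> (i <= j)%N ->
  Aw C j w = gauss #|F| n w * qinv #|F| w (short_moment j C).
Proof.
move=> n_ge2 le_nm C_BMD le_ij; rewrite /Aw (sum_Acol _ _ C_BMD) //.
(* Otherwise n = m, and the column and row sums agree, so their half-sum is either one. *)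
case: ltnP => // le_mn; have eq_mn : m = n by apply/eqP; rewrite eqn_leq le_mn.
subst m; rewrite (sum_Arow _ _ C_BMD) // -mulr2n.
by rewrite -[X in _ * X]mulr_natl mulKf.
Qed.

Theorem lemma4p5 (F : finFieldType) (q n m k i : nat)
    (C : {vspace 'M[F]_(n, m)})
    (cardF : #|F| = q) (n_ge2 : (2 <= n)%N) (le_nm : (n <= m)%N)
    (dimC : \dim C = k) (le_ik : (i <= k)%N) (C_BMD : BMD C i)
    (j : nat) (le_ij : (i <= j)%N) (le_jk : (j <= k)%N) :
  [/\ forall u : int,
        (u < 0 -> bu C j u = 0) /\
        (0 <= u -> bu C j u =
           gauss q (k%:Z - m%:Z * (n%:Z - u - (gen_weight C j)%:Z)) j),
      forall w : nat, (w <= n)%N ->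
        Aw C j w = gauss q n w *
          \sum_(gen_weight C j <= u < w.+1)
             gauss q w u * (-1) ^+ (w - u) * q%:R ^+ 'C(w - u, 2)
               * gauss q (k%:Z - m%:Z * (n%:Z - u%:Z)) j
    & weight_enum C j =
        \sum_(gen_weight C i <= u < n.+1)
           gauss q (k%:Z - m%:Z * (n%:Z - u%:Z)) j *: bernstein q n u].
Proof.
subst q k; have q_gt1 := finNzRing_gt1 F.
have sum_moment := sum_short_moment n_ge2 le_nm C_BMD le_ij.
split.
- move=> u; rewrite /bu; split=> [-> //|u_ge0]; rewrite ltNge u_ge0 /=.
  (* The quotient branch of [bu] is empty for u >= 0: its bound n - d^perp - d_j is at most n -
     d^perp - d_i, which is negative. *)
  case: ifP => // le_u; have := gen_weight_homo C le_ij.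
  by move: C_BMD; rewrite /BMD; lia.
- move=> w le_wn; rewrite (Aw_qinv _ _ _ C_BMD) //; congr (_ * _).
  (* Over [rat^o] scaling is multiplication; [or_intror] selects d_j as the lower bound. *)
  have := sum_moment rat^o _ _ (fun u => gauss #|F| w u * (-1) ^+ (w - u)
             * #|F|%:R ^+ 'C(w - u, 2)) le_wn (or_intror erefl).
  rewrite /qinv => sumE; transitivity (\sum_(u < w.+1) short_moment j C u *:
    (gauss #|F| w u * (-1) ^+ (w - u) * #|F|%:R ^+ 'C(w - u, 2) : rat^o)).
    by apply: eq_bigr => u _; exact: mulrC.
  by rewrite -sumE; apply: eq_bigr => u _; exact: mulrC.
rewrite /weight_enum (sum_moment _ _ _ (bernstein #|F| n) (leqnn n)) //.
  2: by left.
rewrite -bernstein_inversion //; apply: eq_bigr => w _.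
by rewrite (Aw_qinv _ _ _ C_BMD).
Qed.
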